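(* For every $p\in(1,\infty)$ there are states violating strong monotonicity for both $C_{l_p}$ and $C_p$. That is, for every $p\in(1,\infty)$ there exist $d\ge1$ and a state $\rho$ on $\mathbb{C}^d$ such that, for each $C\in\{C_{l_p},C_p\}$, there is a finite family of incoherent Kraus operators $\{K_n\}$, $K_n$ of size $d_n\times d$, with $\sum_nK_n^\dagger K_n=\mathbb{1}_d$, for which $$\sum_{n:\,p_n>0}p_n\,C(\rho_n)>C(\rho),\qquad p_n=\mathrm{Tr}(K_n\rho K_n^\dagger),\quad \rho_n=K_n\rho K_n^\dagger/p_n .$$
   Context: Work in $\mathbb{C}^d$ with its fixed standard basis. A state is a positive semidefinite complex matrix of trace $1$; an incoherent state is a diagonal state, and $\mathcal{I}$ is the set of incoherent states of the relevant dimension. For a matrix $X=(x_{ij})$ and $p\in[1,\infty)$, $\|X\|_{l_p}=\big(\sum_{i,j}|x_{ij}|^p\big)^{1/p}$ and $\|X\|_p=(\mathrm{Tr}|X|^p)^{1/p}$ with $|X|=\sqrt{X^\dagger X}$ (Schatten-$p$ norm). For a state $\rho$, $C_{l_p}(\rho):=\min_{\delta\in\mathcal{I}}\|\rho-\delta\|_{l_p}$ and $C_p(\rho):=\min_{\delta\in\mathcal{I}}\|\rho-\delta\|_p$. A $d'\times d$ matrix $K$ is an incoherent Kraus operator if $K\delta K^\dagger$ is diagonal for every incoherent state $\delta$ on $\mathbb{C}^d$. $\mathbb{1}_d$ is the $d\times d$ identity. *)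

(* Defs.v *)
From mathcomp Require Import all_boot all_order all_algebra.
From mathcomp Require Import complex.
From mathcomp Require Import classical_sets reals exp.

Set Implicit Arguments.
Unset Strict Implicit.
Unset Printing Implicit Defensive.

Import Order.TTheory GRing.Theory Num.Theory.
Local Open Scope ring_scope.
Local Open Scope sesquilinear_scope.
Local Open Scope classical_set_scope.

Section Coherence.
Variable R : realType.
Local Notation C := R[i].

(* [0 <= z] in [R[i]] says that [z] is real and nonnegative. *)
Definition psdmx d (A : 'M[C]_d) : Prop :=
  A \is hermsymmx /\ forall v : 'cV[C]_d, 0 <= (v^t* *m A *m v) 0 0.

Definition state d (rho : 'M[C]_d) : Prop := psdmx rho /\ \tr rho = 1.

Definition incoherent d (delta : 'M[C]_d) : Prop :=
  state delta /\ is_diag_mx delta.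

(* Functional calculus: for a normal matrix A = U^-1 diag(a_i) U with U unitary,
   this is U^-1 diag(f a_i) U; it is junk when A is not normal. *)
Definition mxfun (f : C -> C) d (A : 'M[C]_d) : 'M[C]_d :=
  invmx (spectralmx A) *m diag_mx (map_mx f (spectral_diag A)) *m spectralmx A.

Definition absmx m n (X : 'M[C]_(m, n)) : 'M[C]_n := mxfun sqrtC (X^t* *m X).

(* The p-th power of a positive semidefinite matrix: its eigenvalues are real,
   so taking real parts loses nothing. *)
Definition powmx (p : R) d (A : 'M[C]_d) : 'M[C]_d :=
  mxfun (fun z => (complex.Re z `^ p)%:C%C) A.

Definition lp_norm (p : R) m n (X : 'M[C]_(m, n)) : R :=
  (\sum_(i < m) \sum_(j < n) (complex.Re `|X i j|) `^ p) `^ p^-1.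

Definition schatten_norm (p : R) m n (X : 'M[C]_(m, n)) : R :=
  (complex.Re (\tr (powmx p (absmx X)))) `^ p^-1.

(* The minimum over the compact set of incoherent states is rendered as an
   infimum; for d > 0 the set of values is nonempty and bounded below by 0. *)
Definition coherence_lp (p : R) d (rho : 'M[C]_d) : R :=
  inf [set lp_norm p (rho - delta) | delta in @incoherent d].

Definition coherence_schatten (p : R) d (rho : 'M[C]_d) : R :=
  inf [set schatten_norm p (rho - delta) | delta in @incoherent d].

Definition incoherent_kraus d' d (K : 'M[C]_(d', d)) : Prop :=
  forall delta : 'M[C]_d, incoherent delta -> is_diag_mx (K *m delta *m K^t*).

(* The trace below is real whenever [rho] is Hermitian. *)
Definition outcome_prob d' d (K : 'M[C]_(d', d)) (rho : 'M[C]_d) : R :=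
  complex.Re (\tr (K *m rho *m K^t*)).

Definition outcome_state d' d (K : 'M[C]_(d', d)) (rho : 'M[C]_d) : 'M[C]_d' :=
  ((outcome_prob K rho)%:C%C)^-1 *: (K *m rho *m K^t*).

End Coherence.

(* Main.v *)
(** For a direct sum of two states of weight 1/2 whose optimal incoherent
    approximations are known, an l_p-type distance combines the blocks by the
    l_p norm of the pair, while the average after the block measurement combines
    them by the l_1 norm, which is strictly larger for [1 < p]. We take both
    blocks equal to the maximally coherent qubit state |+><+|. Subtracting 1/4
    times the identity from the direct sum bounds its coherence by
    [(4 (1/4)^p)^(1/p)]; the off-diagonal entries alone bound the coherence of
    |+><+| from below by [(2 (1/2)^p)^(1/p)]. All Schatten norms needed are those
    of multiples of unitaries, for which [X^* X] is scalar. *)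

Require Import Defs.
From mathcomp Require Import all_boot all_order all_algebra.
From mathcomp Require Import complex ring lra.
From mathcomp Require Import classical_sets reals exp.

Set Implicit Arguments.
Unset Strict Implicit.
Unset Printing Implicit Defensive.

Import Order.TTheory GRing.Theory Num.Theory.
Local Open Scope ring_scope.
Local Open Scope sesquilinear_scope.

(** * Spectral calculus at scalar matrices, and positivity of Gram matrices *)

Section Violation.
Variable R : realType.
Local Notation C := R[i].

(** Conjugation fixes scalar matrices, so whichever unitary [spectralmx] picks, the spectral
    diagonal is constantly [c]. *)
Lemma mxfun_scalar (f : C -> C) n (c : C) : mxfun f (c%:M : 'M_n) = (f c)%:M.
Proof.
have cN : (c%:M : 'M_n) \is normalmx.
  apply/normalmxP; rewrite tr_scalar_mx map_scalar_mx /=.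
  by rewrite -!scalar_mxM mulrC.
have /orthomx_spectralP := cN.
set P := spectralmx _; set D := spectral_diag _ => cE.
have Pu : P \in unitmx by apply: spectral_unit.
have DE : D = const_mx c.
  have DM : diag_mx D = c%:M.
    have := congr1 (fun M => P *m M *m invmx P) cE.
    rewrite !mulmxA mulmxV // mul1mx mulmxK // => <-.
    by rewrite mul_mx_scalar -scalemxAl mulmxV // scalemx1.
  apply/rowP => j; have /matrixP/(_ j j) := DM.
  by rewrite !mxE eqxx !mulr1n.
rewrite /mxfun -/P -/D DE map_const_mx diag_const_mx.
by rewrite mul_mx_scalar -scalemxAl mulVmx // scalemx1.
Qed.

(** Here [absmx X] is scalar, so all [n] singular values equal [sqrtC c] and no diagonalization has
    to be computed. *)
Lemma schatten_norm_gram_scalar (p : R) m n (X : 'M[C]_(m, n)) (c : C) :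
  X^t* *m X = c%:M ->
  schatten_norm p X = (n%:R * complex.Re (sqrtC c) `^ p) `^ p^-1.
Proof.
move=> XX; rewrite /schatten_norm /powmx /absmx XX !mxfun_scalar.
by rewrite mxtrace_scalar -rmorphMn /= mulr_natl.
Qed.

(** The quadratic form at [v] is the squared length of [A *m v]. Every positivity claim below goes
    through a Gram factorization. *)
Lemma psdmx_gram m n (A : 'M[C]_(m, n)) : psdmx (A^t* *m A).
Proof.
split.
  by apply/is_hermitianmxP; rewrite expr0 scale1r trmx_mul map_mxM /= trmxCK.
move=> v; rewrite mulmxA -mulmxA.
have -> : v^t* *m A^t* = (A *m v)^t* by rewrite trmx_mul map_mxM.
rewrite mxE; apply: sumr_ge0 => i _.
by rewrite !mxE mulrC mul_conjC_ge0.
Qed.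

Lemma psdmx_scale n (a : C) (A : 'M[C]_n) : 0 <= a -> psdmx A -> psdmx (a *: A).
Proof.
move=> a0 [/is_hermitianmxP AH Ap]; split.
  apply/is_hermitianmxP; rewrite expr0 scale1r.
  apply/matrixP => i j; rewrite {1}AH expr0 scale1r !mxE.
  by rewrite rmorphM /= (geC0_conj a0).
by move=> v; rewrite -scalemxAr -scalemxAl mxE mulr_ge0.
Qed.

Lemma incoherent_scalar d : (0 < d)%N -> incoherent ((d%:R^-1)%:M : 'M[C]_d).
Proof.
move=> d0; split; last exact: scalar_mx_is_diag.
split; last by rewrite mxtrace_scalar -[LHS]mulr_natr mulVf // pnatr_eq0 -lt0n.
rewrite -scalemx1; apply: psdmx_scale; first by rewrite invr_ge0 ler0n.
have -> : (1%:M : 'M[C]_d) = (1%:M)^t* *m 1%:M.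
  by rewrite mulmx1 trmx1 map_mx1.
exact: psdmx_gram.
Qed.

(** * The qubit state |+><+| and its doubled version *)

Definition plus_state : 'M[C]_2 := const_mx 2^-1.

(** A rank-one orthogonal projection is its own Gram matrix, hence positive. *)
Lemma plus_state_gram : plus_state^t* *m plus_state = plus_state.
Proof.
apply/matrixP => i j; rewrite !mxE !big_ord_recl big_ord0 !mxE.
rewrite fmorphV rmorph_nat.
by field.
Qed.

Definition twin_plus_state : 'M[C]_(2 + 2) :=
  2^-1 *: block_mx plus_state 0 0 plus_state.

Lemma twin_plus_state_is_state : state twin_plus_state.
Proof.
split.
  apply: psdmx_scale; first by rewrite invr_ge0 ler0n.
  have -> : block_mx plus_state 0 0 plus_state =
            (block_mx plus_state 0 0 plus_state)^t* *m
            block_mx plus_state 0 0 plus_state.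
    rewrite tr_block_mx map_block_mx mulmx_block !trmx0 !map_mx0.
    by rewrite !mul0mx !mulmx0 !addr0 !add0r plus_state_gram.
  exact: psdmx_gram.
rewrite mxtraceZ mxtrace_block /mxtrace !big_ord_recl !big_ord0 !mxE.
by field.
Qed.

(** [X] is [t] times Pauli Z plus [s] times Pauli X. These anticommute and square to the identity,
    so for real [t] and [s] the cross terms cancel. *)
Lemma gram_traceless2 (X : 'M[C]_2) (t s : C) :
  t^* = t -> s^* = s -> X 0 0 = t -> X 1 1 = - t -> X 0 1 = s -> X 1 0 = s ->
  X^t* *m X = (t ^+ 2 + s ^+ 2)%:M.
Proof.
move=> tr sr x00 x11 x01 x10.
have lift01 : lift ord0 ord0 = 1 :> 'I_2 by apply/val_inj.
have two (i : 'I_2) : i = 0 \/ i = 1.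
  by case: i => [[|[|k]] Hk] //; [left|right]; apply/val_inj.
apply/matrixP => i j.
rewrite !mxE !big_ord_recl big_ord0 !mxE lift01.
case: (two i) => ->; case: (two j) => ->;
  rewrite ?x00 ?x11 ?x01 ?x10 ?rmorphN /= ?tr ?sr ?mulr1n ?mulr0n; ring.
Qed.

Lemma sum_block_diag m n (f : C -> R) (A D : 'M[C]_(m, n)) : f 0 = 0 ->
  \sum_i \sum_j f (block_mx A 0 0 D i j) =
  \sum_i \sum_j f (A i j) + \sum_i \sum_j f (D i j).
Proof.
move=> f0; rewrite big_split_ord /=.
congr (_ + _); apply: eq_bigr => i _; rewrite big_split_ord /=.
  rewrite [X in _ + X]big1 ?addr0 => [|j _]; last by rewrite block_mxEur mxE.
  by apply: eq_bigr => j _; rewrite block_mxEul.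
rewrite [X in X + _]big1 ?add0r => [|j _]; last by rewrite block_mxEdl mxE.
by apply: eq_bigr => j _; rewrite block_mxEdr.
Qed.

(** * Distances from the two states to incoherent states *)

Section Exponent.
Variable p : R.
Hypothesis hp : 1 < p.

Let p_gt0 : 0 < p. Proof. exact: lt_trans hp. Qed.

Lemma powR_invp_mono (a b : R) : 0 <= a -> a <= b -> a `^ p^-1 <= b `^ p^-1.
Proof.
move=> a0 ab; apply: ge0_ler_powR => //; rewrite ?nnegrE ?invr_ge0 ?(ltW p_gt0) //.
exact: le_trans ab.
Qed.

(** Both states have trace 1, so the difference is traceless; [delta] is Hermitian, so [t] is real;
    [delta] is diagonal, so the off-diagonal entries survive. *)
Lemma plus_sub_incoherent (delta : 'M[C]_2) : incoherent delta ->
  exists2 t : C, t^* = t &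
    [/\ (plus_state - delta) 0 0 = t, (plus_state - delta) 1 1 = - t,
        (plus_state - delta) 0 1 = 2^-1 & (plus_state - delta) 1 0 = 2^-1].
Proof.
move=> [[[/is_hermitianmxP dH _] tr1] /is_diag_mxP dD].
have lift01 : lift ord0 ord0 = 1 :> 'I_2 by apply/val_inj.
exists (2^-1 - delta 0 0).
  rewrite rmorphB /= fmorphV rmorph_nat; congr (_ - _).
  by move/matrixP/(_ 0 0): dH; rewrite expr0 scale1r !mxE.
move: tr1; rewrite /mxtrace !big_ord_recl big_ord0 lift01 addr0 => tr1.
split; rewrite !mxE //; [|by rewrite dD ?subr0..].
have -> : delta 1 1 = 1 - delta 0 0 by rewrite -tr1; ring.
by field.
Qed.

(** Both singular values are the root of t^2 + 1/4, hence at least 1/2. *)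
Lemma schatten_plus_ge (delta : 'M[C]_2) : incoherent delta ->
  (2 * 2^-1 `^ p) `^ p^-1 <= schatten_norm p (plus_state - delta).
Proof.
move=> /plus_sub_incoherent[t tr [x00 x11 x01 x10]].
have hr : (2^-1 : C)^* = 2^-1 by rewrite fmorphV rmorph_nat.
rewrite (schatten_norm_gram_scalar _ (gram_traceless2 tr hr x00 x11 x01 x10)).
have h0 : (0 : C) <= 2^-1 by rewrite invr_ge0 ler0n.
have t2 : 0 <= t ^+ 2 by rewrite real_exprn_even_ge0 //; apply/CrealP.
have : sqrtC (2^-1 ^+ 2 : C) <= sqrtC (t ^+ 2 + 2^-1 ^+ 2).
  have h2 : (0 : C) <= 2^-1 ^+ 2 by rewrite exprn_ge0.
  by rewrite ler_sqrtC ?nnegrE ?lerDr ?addr_ge0.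
(* The order on [R[i]] asks for equal imaginary parts and ordered real parts; the latter is kept. *)
rewrite (sqrCK h0) lecE => /andP[_].
have -> : complex.Re (2^-1 : C) = 2^-1.
  have -> : (2^-1 : C) = (2^-1 : R)%:C%C by rewrite fmorphV rmorph_nat.
  by [].
move=> le; apply: powR_invp_mono; first by rewrite mulr_ge0 ?powR_ge0.
rewrite ler_pM2l //; apply: ge0_ler_powR => //; rewrite ?nnegrE ?invr_ge0 ?(ltW p_gt0) //.
by apply: le_trans le; rewrite invr_ge0.
Qed.

Lemma Re_normC_nat_inv n : complex.Re `|(n%:R^-1 : C)| = n%:R^-1.
Proof.
have -> : (n%:R^-1 : C) = (n%:R^-1 : R)%:C%C by rewrite fmorphV rmorph_nat.
by rewrite normc_def /= expr0n addr0 sqrtr_sqr ger0_norm // invr_ge0.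
Qed.

(** The two diagonal terms are nonnegative and are dropped. *)
Lemma lp_plus_ge (delta : 'M[C]_2) : incoherent delta ->
  (2 * 2^-1 `^ p) `^ p^-1 <= lp_norm p (plus_state - delta).
Proof.
move=> /plus_sub_incoherent[t _ [x00 x11 x01 x10]].
have lift01 : lift ord0 ord0 = 1 :> 'I_2 by apply/val_inj.
apply: powR_invp_mono; first by rewrite mulr_ge0 ?powR_ge0.
rewrite !big_ord_recl !big_ord0 lift01 x00 x11 x01 x10 Re_normC_nat_inv.
have := powR_ge0 (complex.Re `|t|) p; have := powR_ge0 (complex.Re `|- t|) p.
lra.
Qed.

(** This is Pauli X divided by 4. *)
Let half_flip : 'M[C]_2 := 2^-1 *: (plus_state - (2^-1)%:M).

Lemma twin_plus_sub_quarter :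
  twin_plus_state - (4^-1)%:M = block_mx half_flip 0 0 half_flip.
Proof.
rewrite /twin_plus_state (scalar_mx_block 2 2) opp_block_mx scale_block_mx.
rewrite add_block_mx !scaler0 !oppr0 !addr0 /half_flip scalerBr.
rewrite scale_scalar_mx.
by have -> : (4^-1 : C) = 2^-1 * 2^-1 by field.
Qed.

Let half_flipE : [/\ half_flip 0 0 = 0, half_flip 1 1 = 0,
   half_flip 0 1 = 4^-1 & half_flip 1 0 = 4^-1].
Proof. by split; rewrite !mxE /= ?mulr1n ?mulr0n; field. Qed.

Lemma schatten_twin_plus :
  schatten_norm p (twin_plus_state - (4^-1)%:M) = (4 * 4^-1 `^ p) `^ p^-1.
Proof.
rewrite twin_plus_sub_quarter; set X := block_mx _ _ _ _.
have XX : X^t* *m X = (4^-1 ^+ 2)%:M.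
  have qr : (4^-1 : C)^* = 4^-1 by rewrite fmorphV rmorph_nat.
  have [x00 x11 x01 x10] := half_flipE.
  rewrite /X tr_block_mx map_block_mx mulmx_block !trmx0 !map_mx0.
  rewrite !mul0mx !mulmx0 !addr0 !add0r.
  rewrite (gram_traceless2 (conjC0 _) qr x00 _ x01 x10) ?oppr0 //.
  by rewrite expr0n add0r -scalar_mx_block.
have q0 : (0 : C) <= 4^-1 by rewrite invr_ge0 ler0n.
rewrite (schatten_norm_gram_scalar _ XX) (sqrCK q0).
have -> : (4^-1 : C) = (4^-1 : R)%:C%C by rewrite fmorphV rmorph_nat.
by [].
Qed.

Lemma lp_twin_plus :
  lp_norm p (twin_plus_state - (4^-1)%:M) = (4 * 4^-1 `^ p) `^ p^-1.
Proof.
have lift01 : lift ord0 ord0 = 1 :> 'I_2 by apply/val_inj.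
have [x00 x11 x01 x10] := half_flipE.
rewrite twin_plus_sub_quarter /lp_norm; congr (_ `^ _).
rewrite (sum_block_diag (f := fun z => complex.Re `|z| `^ p)); last first.
  (* The zero blocks contribute nothing because [p] is nonzero. *)
  by rewrite normr0 powR0 ?gt_eqF.
rewrite !big_ord_recl !big_ord0 lift01 x00 x11 x01 x10 normr0.
rewrite Re_normC_nat_inv powR0 ?gt_eqF //.
ring.
Qed.

(** With a = (1/2)^p the claim reduces to 4a^2 < 2a, that is a < 1/2, which is exactly p > 1. *)
Lemma two_block_gap :
  (4 * 4^-1 `^ p) `^ p^-1 < (2 * 2^-1 `^ p) `^ p^-1 :> R.
Proof.
have h0 : (0 : R) < 2^-1 by rewrite invr_gt0.
apply: gt0_ltr_powR; rewrite ?nnegrE ?invr_gt0 ?mulr_ge0 ?powR_ge0 //.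
have -> : (4^-1 : R) = 2^-1 * 2^-1 by field.
rewrite powRM ?(ltW h0) //.
set a := 2^-1 `^ p.
have a0 : 0 < a by exact: powR_gt0.
have a1 : a < 2^-1.
  have -> : a = 2^-1 * 2^-1 `^ (p - 1) by rewrite mulr_powRB1 ?(ltW h0).
  rewrite gtr_pMr //.
  have e1 : 1 `^ (p - 1) = 1 :> R by rewrite powR1.
  rewrite -[ltRHS]e1.
  by apply: gt0_ltr_powR; rewrite ?subr_gt0 ?nnegrE ?(ltW h0) //; lra.
nra.
Qed.

End Exponent.

End Violation.

Lemma coherence_lp_twin_plus_lt (R : realType) (p : R) : 1 < p ->
  coherence_lp p (twin_plus_state R) < coherence_lp p (plus_state R).
Proof.
move=> hp.
apply: (@le_lt_trans _ _ ((4 * 4^-1 `^ p) `^ p^-1)); last first.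
  apply: lt_le_trans (two_block_gap hp) _; apply: lb_le_inf.
    (* A pointwise lower bound passes to the infimum of a nonempty set; the maximally mixed qubit is
       a member. *)
    by eexists; exists (2^-1)%:M => //; exact: incoherent_scalar.
  by move=> _ [delta dI <-]; apply: lp_plus_ge.
apply: ge_inf; first by exists 0 => _ [delta _ <-]; exact: powR_ge0.
by exists (4^-1)%:M; [exact: (@incoherent_scalar R 4)|exact: lp_twin_plus].
Qed.

Lemma coherence_schatten_twin_plus_lt (R : realType) (p : R) : 1 < p ->
  coherence_schatten p (twin_plus_state R) < coherence_schatten p (plus_state R).
Proof.
move=> hp.
apply: (@le_lt_trans _ _ ((4 * 4^-1 `^ p) `^ p^-1)); last first.
  apply: lt_le_trans (two_block_gap hp) _; apply: lb_le_inf.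
    by eexists; exists (2^-1)%:M => //; exact: incoherent_scalar.
  by move=> _ [delta dI <-]; apply: schatten_plus_ge.
apply: ge_inf; first by exists 0 => _ [delta _ <-]; exact: powR_ge0.
by exists (4^-1)%:M; [exact: (@incoherent_scalar R 4)|exact: schatten_twin_plus].
Qed.

(** * The measurement that reveals the block *)

Section BlockMeasurement.
Variable R : realType.
Local Notation C := R[i].

Definition block_kraus (n : 'I_2) : 'M[C]_(2, 2 + 2) :=
  if n == 0 then row_mx 1%:M 0 else row_mx 0 1%:M.

Lemma block_kraus_conj (n : 'I_2) (A B D E : 'M[C]_2) :
  block_kraus n *m block_mx A B D E *m (block_kraus n)^t* =
  if n == 0 then A else E.
Proof.
rewrite /block_kraus; case: ifP => _;
  rewrite tr_row_mx map_col_mx mul_row_block mul_row_col !trmx0 !trmx1;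
  by rewrite !map_mx0 !map_mx1 !mul0mx !mul1mx !mulmx0 !mulmx1 ?addr0 ?add0r.
Qed.

(** The compression of [delta] is one of its diagonal blocks, which is again diagonal. *)
Lemma block_kraus_incoherent (n : 'I_2) : incoherent_kraus (block_kraus n).
Proof.
move=> delta [_ /is_diag_mxP dD].
rewrite -[delta]submxK block_kraus_conj.
by apply/is_diag_mxP => i j ij; case: ifP => _; rewrite !mxE dD.
Qed.

Lemma block_kraus_complete :
  \sum_(n < 2) (block_kraus n)^t* *m block_kraus n = 1%:M.
Proof.
rewrite !big_ord_recl big_ord0 addr0 /block_kraus /=.
rewrite !tr_row_mx !map_col_mx !mul_col_row !trmx0 !trmx1 !map_mx0 !map_mx1.
rewrite !mul0mx !mulmx0 !mulmx1 add_block_mx !addr0 !add0r.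
by rewrite -scalar_mx_block.
Qed.

Lemma block_kraus_twin_plus (n : 'I_2) :
  block_kraus n *m twin_plus_state R *m (block_kraus n)^t* =
  2^-1 *: plus_state R.
Proof. by rewrite -scalemxAr -scalemxAl block_kraus_conj if_same. Qed.

Lemma outcome_prob_twin_plus (n : 'I_2) :
  outcome_prob (block_kraus n) (twin_plus_state R) = 2^-1.
Proof.
rewrite /outcome_prob block_kraus_twin_plus mxtraceZ /mxtrace.
rewrite !big_ord_recl big_ord0 !mxE.
have -> : (2^-1 * (2^-1 + (2^-1 + 0)) : C) = (2^-1 : R)%:C%C.
  by rewrite fmorphV rmorph_nat; field.
by [].
Qed.

Lemma outcome_state_twin_plus (n : 'I_2) :
  outcome_state (block_kraus n) (twin_plus_state R) = plus_state R.
Proof.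
rewrite /outcome_state outcome_prob_twin_plus block_kraus_twin_plus.
by rewrite scalerA fmorphV rmorph_nat mulVf ?scale1r // invr_eq0 pnatr_eq0.
Qed.

End BlockMeasurement.

Theorem proposition8 (R : realType) (p : R) (hp : 1 < p) :
  exists (d : nat) (rho : 'M[R[i]]_d),
    [/\ (0 < d)%N, state rho &
      forall C : (forall e : nat, 'M[R[i]]_e -> R),
        C = @coherence_lp R p \/ C = @coherence_schatten R p ->
        exists (N : nat) (dim : 'I_N -> nat)
               (K : forall n : 'I_N, 'M[R[i]]_(dim n, d)),
          [/\ forall n, (0 < dim n)%N,
              forall n, incoherent_kraus (K n),
              \sum_(n < N) (K n)^t* *m K n = 1%:M &
              C d rho <
                \sum_(n < N | 0 < outcome_prob (K n) rho)
                  outcome_prob (K n) rho * C (dim n) (outcome_state (K n) rho)]].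
Proof.
exists (2 + 2)%N, (twin_plus_state R); split => //.
  exact: twin_plus_state_is_state.
move=> C HC; exists 2%N, (fun=> 2%N), (@block_kraus R); split => //.
- exact: block_kraus_incoherent.
- exact: block_kraus_complete.
- have lt : C _ (twin_plus_state R) < C _ (plus_state R).
    case: HC => ->; first exact: coherence_lp_twin_plus_lt.
    exact: coherence_schatten_twin_plus_lt.
  (* Each outcome has probability 1/2 and leaves |+><+|, so the average is the coherence of that
     state. *)
  rewrite big_mkcond !big_ord_recl big_ord0 /= !outcome_prob_twin_plus.
  rewrite !outcome_state_twin_plus invr_gt0 ltr0n /=.
  lra.
Qed.
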